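(* Let $q$ be a prime power, let $L,M\in\mathbb{F}_{q^2}[x]$ and $\beta\in\mu_{q+1}$ be such that $L\sim_{\beta}M$, and let $k\ge 0$ be an integer. Then the polynomial $x^{\deg(L)+k(q+1)}M(x^{q-1})$ permutes $\mathbb{F}_{q^2}$ if and only if $\gcd(\deg(L)+2k,\,q-1)=1$ and $L/M$ permutes $\mu_{q+1}$.
   Context: $\mu_{q+1}=\{x\in\mathbb{F}_{q^2}: x^{q+1}=1\}$. A polynomial permutes $\mathbb{F}_{q^2}$ if the induced map $\mathbb{F}_{q^2}\to\mathbb{F}_{q^2}$ is a bijection. For distinct polynomials $L,M\in\mathbb{F}_{q^2}[x]$ of the same degree and $\beta\in\mu_{q+1}$, one says that $L$ and $M$ are $\beta$-associated, written $L\sim_\beta M$, if $L(x)^q=\beta x^{-\deg(L)}M(x)$ for every $x\in\mu_{q+1}$. ''$L/M$ permutes $\mu_{q+1}$'' means that $M$ has no root in $\mu_{q+1}$ and $x\mapsto L(x)/M(x)$ is a bijection of $\mu_{q+1}$ onto itself. *)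

(* Defs.v *)
From mathcomp Require Import all_boot all_algebra all_field.

Set Implicit Arguments.
Unset Strict Implicit.
Unset Printing Implicit Defensive.

Import GRing.Theory.
Local Open Scope ring_scope.

Definition prime_power (q : nat) : Prop :=
  exists p e : nat, [/\ prime p, (0 < e)%N & q = (p ^ e)%N].

Definition degree (R : nzRingType) (P : {poly R}) : nat := (size P).-1.

(* When #|F| = q ^ 2, this is the group usually written mu_(q+1). *)
Definition mu (F : finFieldType) (n : nat) : {set F} :=
  [set x | x ^+ n == 1].

(* Equality of the sizes is equality of the degrees: together with L != M it
   also forces both polynomials to be nonzero. *)
Definition associated (F : finFieldType) (q : nat) (beta : F)
    (L M : {poly F}) : Prop :=
  [/\ L != M, size L = size M &
      forall x, x \in mu F q.+1 ->
        L.[x] ^+ q = beta * x ^- degree L * M.[x]].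

Definition poly_permutes (F : finFieldType) (P : {poly F}) : Prop :=
  bijective (fun x : F => P.[x]).

(* The no-root condition is essential, since y / 0 = 0 in a fieldType. *)
Definition ratfun_permutes (F : finFieldType) (D : {set F})
    (L M : {poly F}) : Prop :=
  [/\ forall x, x \in D -> ~~ root M x,
      {in D &, injective (fun x => L.[x] / M.[x])} &
      [set L.[x] / M.[x] | x in D] = D].

(* Main.v *)
Require Import Defs.
From mathcomp Require Import all_boot all_algebra all_solvable all_field.

(* Put f x = x^(d + k(q+1)) M(x^(q-1)) with d = deg L.  Association is symmetric,
   M(y)^q = beta y^(-d) L(y) on mu_(q+1), so for x <> 0 and y = x^(q-1) one gets
   f(x)^(q-1) = y^d M(y)^(q-1) = beta L(y) / M(y): the map x |-> x^(q-1), which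
   sends F^* onto mu_(q+1) with the elements of F_q^* as kernel, semiconjugates
   f to beta L / M.  On each fibre, f (a x) = a^(d + 2k) f x for a in F_q^*, and
   a |-> a^(d + 2k) is injective on F_q^* exactly when gcd(d + 2k, q - 1) = 1. *)

Set Implicit Arguments.
Unset Strict Implicit.
Unset Printing Implicit Defensive.

Import GRing.Theory.
Local Open Scope ring_scope.

(** Every nonzero element is a root of X^(|F|-1) - 1, which supplies as many distinct roots as its
    degree; [has_prim_root] then yields a primitive one. *)
Lemma finField_prim_root (F : finFieldType) :
  exists2 z : F, z != 0 & #|F|.-1.-primitive_root z.
Proof.
have F1 := finNzRing_gt1 F.
have /hasP[z z0 prim_z] : has #|F|.-1.-primitive_root (enum (predC1 (0 : F))).
  apply: has_prim_root; rewrite ?enum_uniq //.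
  - by rewrite -subn1 subn_gt0.
  - apply/allP => x; rewrite mem_enum inE => x0; apply/unity_rootP.
    apply: (mulfI x0); rewrite -exprS prednK ?expf_card ?mulr1 //.
    exact: ltnW.
  - by rewrite -cardE -(cardC1 (0 : F)).
by exists z; rewrite // mem_enum in z0.
Qed.

Section QuadraticExtension.

Variables (q : nat) (F : finFieldType).
Hypothesis cardF : #|F| = (q ^ 2)%N.

Lemma base_card_gt1 : (1 < q)%N.
Proof.
by have := finNzRing_gt1 F; rewrite cardF; case: (q) => [|[]].
Qed.

Lemma card_pred_factor : #|F|.-1 = (q.-1 * q.+1)%N.
Proof.
have q1 := base_card_gt1.
by rewrite cardF -subn1 -{2}(exp1n 2) subn_sqr subn1 addn1.
Qed.

Lemma mu_neq0 (n : nat) (y : F) : y \in mu F n.+1 -> y != 0.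
Proof.
by rewrite inE; apply: contraTneq => ->; rewrite expr0n eq_sym oner_eq0.
Qed.

Lemma expf_pred_mu (x : F) : x != 0 -> x ^+ q.-1 \in mu F q.+1.
Proof.
move=> x0; rewrite inE -exprM -card_pred_factor; apply/eqP/(mulfI x0).
by rewrite -exprS prednK ?expf_card ?mulr1 // ltnW // finNzRing_gt1.
Qed.

(** For a generator z, of order (q-1)(q+1), y = z^i satisfies y^(q+1) = 1 only if q-1 divides i. *)
Lemma mu_expf_pred (y : F) :
  y \in mu F q.+1 -> exists2 x : F, x != 0 & y = x ^+ q.-1.
Proof.
move=> ymu; have [z z0 prim_z] := finField_prim_root F.
have yN : y ^+ #|F|.-1 = 1.
  by move: ymu; rewrite card_pred_factor mulnC exprM inE => /eqP->; rewrite expr1n.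
have [i yi] := prim_rootP prim_z yN.
move: ymu; rewrite inE yi -exprM -(prim_order_dvd prim_z).
rewrite [X in (X %| _)%N]card_pred_factor dvdn_pmul2r // => /dvdnP[j ij].
by exists (z ^+ j); rewrite ?expf_neq0 // -exprM -ij.
Qed.

(** Serves to show that a constant L/M cannot be injective on mu_(q+1). *)
Lemma mu_nontrivial : exists2 y : F, y \in mu F q.+1 & y != 1.
Proof.
have [z z0 prim_z] := finField_prim_root F.
exists (z ^+ q.-1); first exact: expf_pred_mu.
rewrite -(prim_order_dvd prim_z) card_pred_factor.
have q1 := base_card_gt1; have q0 : (0 < q.-1)%N by rewrite -subn1 subn_gt0.
by rewrite -{2}[q.-1]muln1 dvdn_pmul2l // dvdn1; case: (q) q1.
Qed.

Lemma gcdn_pred_expf_eq1 (n : nat) :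
  gcdn n q.-1 = 1%N <->
  (forall a : F, a ^+ q.-1 = 1 -> a ^+ n = 1 -> a = 1).
Proof.
have q1 := base_card_gt1; have q0 : (0 < q.-1)%N by rewrite -subn1 subn_gt0.
split=> [cop a aq an | inj].
  have [m prim_a mq] := prim_order_exists q0 aq.
  have mn : (m %| n)%N by rewrite (prim_order_dvd prim_a) an.
  apply/eqP; rewrite -[a]expr1 -(prim_order_dvd prim_a) -cop dvdn_gcd.
  by rewrite mn mq.
have [z _ prim_z] := finField_prim_root F.
have gN : (gcdn n q.-1 %| #|F|.-1)%N.
  by rewrite card_pred_factor dvdn_mulr // dvdn_gcdr.
(* A root of unity w of order exactly g = gcd(n, q-1) is killed by both exponents, so w = 1 and g =
   1. *)
have prim_w := dvdn_prim_root prim_z gN.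
apply/eqP; rewrite -dvdn1 (prim_order_dvd prim_w) expr1; apply/eqP/inj; apply/eqP;
  by rewrite -(prim_order_dvd prim_w) (dvdn_gcdr, dvdn_gcdl).
Qed.

Variables (L M : {poly F}) (beta : F).
Hypotheses (beta_mu : beta \in mu F q.+1) (assLM : associated q beta L M).

(** The q-th power map is an involution of F, and it inverts both beta and y; applying it to the
    relation for L gives the one for M. *)
Lemma associated_sym (y : F) : y \in mu F q.+1 ->
  M.[y] ^+ q = beta * y ^- degree L * L.[y].
Proof.
move=> ymu; have [_ _ /(_ y ymu) Ly] := assLM.
have y0 := mu_neq0 ymu.
have -> : L.[y] = L.[y] ^+ q ^+ q by rewrite -exprM mulnn -cardF expf_card.
rewrite Ly !exprMn !mulrA [beta * _]mulrC -[_ * beta * _]mulrA -exprS.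
move: beta_mu ymu; rewrite !inE => /eqP-> /eqP y1; rewrite mulr1.
by rewrite -exprVn -[_ ^+ _ ^+ q]exprM mulnC exprM -exprMn -exprS exprVn y1
  invr1 expr1n mul1r.
Qed.

Variable k : nat.

Let f (x : F) : F := x ^+ (degree L + k * q.+1) * M.[x ^+ q.-1].

Lemma twist_pred_exp (x : F) : x != 0 -> ~~ root M (x ^+ q.-1) ->
  f x ^+ q.-1 = beta * (L.[x ^+ q.-1] / M.[x ^+ q.-1]).
Proof.
move=> x0 My; have ymu := expf_pred_mu x0.
rewrite /f exprMn -exprM mulnC exprM.
set y := x ^+ q.-1 in My ymu *; have y0 := mu_neq0 ymu.
have q1 := base_card_gt1.
have -> : M.[y] ^+ q.-1 = M.[y] ^+ q / M.[y].
  by apply: (canRL (mulfK My)); rewrite -exprSr prednK // ltnW.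
rewrite associated_sym // exprD mulnC exprM.
move: ymu; rewrite inE => /eqP->; rewrite expr1n mulr1.
by rewrite [beta * _]mulrC -!mulrA mulVKf ?expf_neq0.
Qed.

Lemma twist_scale (a x : F) : a ^+ q.-1 = 1 ->
  f (a * x) = a ^+ (degree L + 2 * k) * f x.
Proof.
move=> aq; have q1 := base_card_gt1.
rewrite /f !exprMn aq mul1r -mulrA; congr (_ * _).
(* Modulo q-1, k(q+1) is 2k; this is the source of the exponent d + 2k. *)
have -> : q.+1 = (q.-1 + 2)%N by rewrite addn2 prednK // ltnW.
by rewrite mulnDr mulnC addnCA mulnC exprD mulnC exprM aq expr1n mul1r mulnC.
Qed.

(* When the exponent vanishes, 0 ^+ 0 = 1 and f need not kill 0; but then L and
   M are constant, which both sides of the equivalence exclude. *)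
Lemma twist0 :
  f 0 = 0 \/ f 0 = f 1 /\ exists l m : F, L = l%:P /\ M = m%:P.
Proof.
have [|r0] := posnP (degree L + k * q.+1)%N; last first.
  by left; rewrite /f expr0n gtn_eqF // mul0r.
move=> r0; move/eqP: (r0); rewrite addn_eq0 => /andP[dL _]; right.
have [_ sLM _] := assLM.
have L1 : (size L <= 1)%N by move: dL; rewrite /degree; case: (size L) => [|[]].
have Mm : M = (M`_0)%:P by apply: size1_polyC; rewrite -sLM.
split; first by rewrite /f r0 !expr0 Mm !hornerC.
by exists L`_0, M`_0; split=> //; apply: size1_polyC.
Qed.

Lemma twist_permutes :
  injective f <->
  gcdn (degree L + 2 * k) q.-1 = 1%N /\ ratfun_permutes (mu F q.+1) L M.
Proof.
have beta0 := mu_neq0 beta_mu.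
split=> [injf | [cop [noroot injg _]]].
  have f0 : f 0 = 0.
    by case: twist0 => // -[/injf/esym/eqP]; rewrite oner_eq0.
  have f_neq0 x : x != 0 -> f x != 0.
    by apply: contraNneq => fx; rewrite -(inj_eq injf) f0 fx.
  have noroot y : y \in mu F q.+1 -> ~~ root M y.
    move=> /mu_expf_pred[x x0 ->]; apply: contraNN (f_neq0 x x0) => /eqP My.
    by rewrite /f My mulr0.
  have img : [set L.[y] / M.[y] | y in mu F q.+1] = mu F q.+1.
    have betaM y : (beta * y \in mu F q.+1) = (y \in mu F q.+1).
      by move: beta_mu; rewrite !inE exprMn => /eqP->; rewrite mul1r.
    apply/setP=> z; apply/imsetP/idP => [[y ymu ->] | zmu].
      have [x x0 yx] := mu_expf_pred ymu.
      by rewrite -betaM yx -twist_pred_exp -?yx ?noroot // expf_pred_mu ?f_neq0.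
    have [w w0 zw] : exists2 w, w != 0 & beta * z = w ^+ q.-1.
      by apply: mu_expf_pred; rewrite betaM.
    (* Finiteness makes f surjective: a preimage of w has a (q-1)-th power that L/M sends to z. *)
    have [finv _ fK] := injF_bij injf.
    have x0 : finv w != 0.
      by apply: contraNneq w0 => fw0; rewrite -[w]fK fw0 f0.
    exists (finv w ^+ q.-1); first exact: expf_pred_mu.
    apply: (mulfI beta0); rewrite -twist_pred_exp ?noroot ?expf_pred_mu //.
    by rewrite fK.
  (* A map of the finite set mu_(q+1) onto itself is injective. *)
  split; last by split=> //; apply/imset_injP; rewrite img.
  apply/gcdn_pred_expf_eq1 => a aq an; apply: injf.
  by rewrite -[a]mulr1 twist_scale // an mul1r.
have f_neq0 x : x != 0 -> f x != 0.
  move=> x0; rewrite mulf_neq0 ?expf_neq0 //.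
  exact/noroot/expf_pred_mu.
have f0 : f 0 = 0.
  case: twist0 => // -[_ [l [m [Ll Mm]]]].
  (* Constant L and M would give L/M the same value at 1 and at some y <> 1 in mu_(q+1). *)
  have [y ymu] := mu_nontrivial; case/eqP; apply: injg => //.
    by rewrite inE expr1n.
  by rewrite Ll Mm !hornerC.
have f_eq0 x : (f x == 0) = (x == 0).
  by have [->|/f_neq0/negPf//] := eqVneq x 0; rewrite f0 eqxx.
move=> x x' fxx'; have [x0|x0] := eqVneq x 0.
  by apply/esym/eqP; rewrite x0 -f_eq0 -fxx' x0 f0.
have x'0 : x' != 0 by rewrite -f_eq0 -fxx' f_eq0.
(* Injectivity of L/M puts x and x' in one fibre; their ratio then lies in F_q^*, where the gcd
   condition forces it to be 1. *)
have xx' : x ^+ q.-1 = x' ^+ q.-1.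
  apply: injg; rewrite ?expf_pred_mu //; apply: (mulfI beta0).
  by rewrite -!twist_pred_exp ?noroot ?expf_pred_mu // fxx'.
have aq : (x / x') ^+ q.-1 = 1 by rewrite expr_div_n xx' divff ?expf_neq0.
have an : (x / x') ^+ (degree L + 2 * k) = 1.
  apply: (mulIf (f_neq0 _ x'0)).
  by rewrite -twist_scale // divfK // fxx' mul1r.
by apply: (divIf x'0); rewrite divff // ((gcdn_pred_expf_eq1 _).1 cop _ aq an).
Qed.

End QuadraticExtension.

Theorem theorem3p1 (q : nat) (hq : prime_power q)
    (F : finFieldType) (hF : #|F| = (q ^ 2)%N)
    (L M : {poly F}) (beta : F) (hbeta : beta \in mu F q.+1)
    (hLM : associated q beta L M) (k : nat) :
  poly_permutes
    ('X^(degree L + k * q.+1)%N * (M \Po 'X^(q.-1))) <->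
  gcdn (degree L + 2 * k) q.-1 = 1%N /\
  ratfun_permutes (mu F q.+1) L M.
Proof.
apply: iff_trans (twist_permutes hF hbeta hLM k).
have eval x : ('X^(degree L + k * q.+1)%N * (M \Po 'X^(q.-1))).[x] =
    x ^+ (degree L + k * q.+1) * M.[x ^+ q.-1].
  by rewrite hornerM hornerXn horner_comp hornerXn.
split=> [/bij_inj inj x y | inj].
  by rewrite -!eval; apply: inj.
by apply: injF_bij => x y; rewrite !eval; apply: inj.
Qed.
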